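(* There exists an absolute constant $C>0$ such that the following holds for any $0<\varepsilon\le 1$. Let $n\ge 1$, let $\mathcal{X}=\mathcal{X}_1\times\cdots\times\mathcal{X}_n$ be a product of finite state spaces and let $\pi$ be any probability distribution on $\mathcal{X}$. Then for any permutation $\sigma:[n]\to[n]$, $$t^{\mathsf{SS}(\sigma)}_{\mathrm{mix}}(\varepsilon)\le C\,n\,t^{\mathsf{GD}}_{\mathrm{mix}}(1/4)\,\log\left(\frac{1}{\varepsilon\pi_{\min}}\right),$$ where $\pi_{\min}:=\min_{x\in\mathcal{X}:\pi(x)\ne 0}\pi(x)$. This bound is tight up to the logarithmic factor, in the following sense: there is an absolute constant $c>0$ such that for every $n\ge 1$ there exist a product $\mathcal{X}=\mathcal{X}_1\times\cdots\times\mathcal{X}_n$ of finite state spaces and a distribution $\pi$ on $\mathcal{X}$ such that for every permutation $\sigma:[n]\to[n]$, $t^{\mathsf{SS}(\sigma)}_{\mathrm{mix}}(1/4)\ge c\,n\,t^{\mathsf{GD}}_{\mathrm{mix}}(1/4)$.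
   Context: Notation: $[n]=\{1,\dots,n\}$. For $i\in[n]$, $\mathsf{P}_i$ is the Markov kernel that rerandomizes the $i$-th coordinate according to the conditional distribution of $\pi$ given all other coordinates; it acts on functions by $\mathsf{P}_i f(x)=\mathbb{E}_{X\sim\pi}[f(X)\mid X_{-i}=x_{-i}]$, where $x_{-i}$ is the restriction of $x$ to the coordinates other than $i$. All chains are considered on the support $\{x:\pi(x)\neq 0\}$ of $\pi$. Glauber dynamics has transition matrix $\mathsf{P}_{\mathsf{GD}}=\frac1n\sum_{i=1}^n\mathsf{P}_i$. The systematic scan with order $\sigma$ has transition matrix $\mathsf{P}_\sigma=\mathsf{P}_{\sigma(n)}\cdots\mathsf{P}_{\sigma(1)}$; one step of this chain is a full round of $n$ site updates. Total variation distance: $d_{\mathsf{TV}}(\mu,\nu)=\frac12\sum_x|\mu(x)-\nu(x)|$. For a transition matrix $\mathsf{P}$ with stationary distribution $\pi$, the mixing time is $t^{\mathsf{P}}_{\mathrm{mix}}(\varepsilon)=\min\{t\ge 0:\max_x d_{\mathsf{TV}}(\mathsf{P}^t(x,\cdot),\pi)\le\varepsilon\}$, the maximum being over the support of $\pi$, with value $\infty$ if no such $t$ exists (inequalities with infinite right-hand side are regarded as trivially true). $t^{\mathsf{GD}}_{\mathrm{mix}}$ and $t^{\mathsf{SS}(\sigma)}_{\mathrm{mix}}$ denote the mixing times of $\mathsf{P}_{\mathsf{GD}}$ and $\mathsf{P}_\sigma$. *)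

(* Defs.v *)
From HB Require Import structures.
From mathcomp Require Import all_boot all_order all_algebra all_fingroup.
From mathcomp Require Import boolp reals ereal constructive_ereal exp.

Set Implicit Arguments.
Unset Strict Implicit.
Unset Printing Implicit Defensive.

Import Order.TTheory GRing.Theory Num.Theory.
Local Open Scope ring_scope.

Definition config (n : nat) (X : 'I_n -> finType) : finType :=
  {dffun forall i : 'I_n, X i}.

Definition is_distr (R : realType) (T : finType) (pi : T -> R) : Prop :=
  (forall x, 0 <= pi x) /\ \sum_x pi x = 1.

Definition supp (R : realType) (T : finType) (pi : T -> R) : {set T} :=
  [set x | pi x != 0].

(* All probabilities are at most 1, so the unit 1 of the iterated minimum never
   interferes with the minimum over the (nonempty) support. *)
Definition pi_min (R : realType) (T : finType) (pi : T -> R) : R :=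
  \big[Num.min/1]_(x in supp pi) pi x.

Definition dTV (R : realType) (T : finType) (mu nu : T -> R) : R :=
  2^-1 * \sum_x `|mu x - nu x|.

(* Chains on the support of pi are square matrices of size #|supp pi|, the state
   with index a being [enum_val a]. *)
Definition stat (R : realType) (T : finType) (pi : T -> R) :
  'I_#|supp pi| -> R := fun a => pi (enum_val a).
Arguments stat {R T} pi a.

Section MixingTime.
Variables (R : realType) (m : nat) (P : 'M[R]_m) (p : 'I_m -> R).

(* Total variation distances are nonnegative, so the unit 0 of the iterated
   maximum is harmless. *)
Definition tv_dist (t : nat) : R := \big[Num.max/0]_(a < m) dTV ((P ^+ t) a) p.

Definition tmix (eps : R) : \bar R :=
  match pselect (exists t, tv_dist t <= eps) with
  | left ex => (ex_minn ex)%:R%:E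
  | right _ => +oo%E
  end.

End MixingTime.

Section SiteUpdates.
Variables (R : realType) (n : nat) (X : 'I_n -> finType).
Implicit Types (pi : config X -> R) (i : 'I_n) (x y : config X).

Definition agree_off i x y : bool := [forall j, (j != i) ==> (x j == y j)].

Definition cond_exp pi i (f : config X -> R) x : R :=
  (\sum_(z | agree_off i x z) pi z * f z) / \sum_(z | agree_off i x z) pi z.

Definition P_site pi i : 'M[R]_#|supp pi| :=
  \matrix_(a, b) cond_exp pi i (fun z => (z == enum_val b)%:R) (enum_val a).

Lemma P_siteE pi i (f : config X -> R) (a : 'I_#|supp pi|) :
  (P_site pi i *m \col_b f (enum_val b)) a ord0 = cond_exp pi i f (enum_val a).
Proof.
rewrite mxE /cond_exp; under eq_bigr => b _ do rewrite !mxE mulrAC mulr_suml.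
rewrite -mulr_suml exchange_big /=; congr (_ / _); apply: eq_bigr => z _.
under eq_bigr => b _ do rewrite -mulrA; rewrite -mulr_sumr.
have [z0|z0] := eqVneq (pi z) 0; first by rewrite z0 !mul0r.
have zS : z \in supp pi by rewrite inE.
rewrite (bigD1 (enum_rank_in zS z)) //= enum_rankK_in // eqxx mul1r.
rewrite big1 ?addr0 // => b /eqP nb; case: eqP => [e|_]; rewrite ?mul0r //.
by case: nb; apply: enum_val_inj; rewrite enum_rankK_in.
Qed.

Definition P_GD pi : 'M[R]_#|supp pi| := n%:R^-1 *: \sum_(i < n) P_site pi i.

(* Sites are indexed from 0, so the factors are, from left to right,
   sigma (n - 1), ..., sigma 0. *)
Definition P_SS pi (sigma : {perm 'I_n}) : 'M[R]_#|supp pi| :=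
  \prod_(i < n) P_site pi (sigma (rev_ord i)).

Definition tmix_GD pi (eps : R) : \bar R := tmix (P_GD pi) (stat pi) eps.

Definition tmix_SS pi (sigma : {perm 'I_n}) (eps : R) : \bar R :=
  tmix (P_SS pi sigma) (stat pi) eps.

End SiteUpdates.

(* Main.v *)
Require Import Defs.
From HB Require Import structures.
From mathcomp Require Import all_boot all_order all_algebra all_fingroup.
From mathcomp Require Import boolp reals ereal constructive_ereal exp.
From mathcomp Require Import sequences ring lra zify.

Import Order.TTheory GRing.Theory Num.Theory.
Local Open Scope ring_scope.

Set Implicit Arguments.
Unset Strict Implicit.
Unset Printing Implicit Defensive.

(** Upper bound. In L2(pi) each site update P_i is an orthogonal projection. If
    Glauber dynamics is 1/4-mixed at time T, then P_GD^T halves the sup norm of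
    every mean-zero f; since P_GD is positive semidefinite, the moments
    <f, P_GD^k f> decay at best geometrically with ratio <f, P_GD f> / <f, f>, so
    this ratio rho satisfies 2 rho^T <= 1 and the spectral gap is at least
    1 / (2T) ([spectral_gap]). Now let f pass through the n projections of one
    scan. The squared norm lost is the sum of the squared lengths of the steps.
    If this loss is E, then every intermediate point is within squared distance
    n E of f, hence f is that close to the range of every P_i; summing over i,
    the gap inequality turns into E >= ||f||^2 / (2 T n) ([sweep_loss],
    [scan_contraction]). So one scan contracts the squared norm by the factor
    1 - 1 / (2 T n), and O(n T log(1 / (eps pi_min))) scans bring the total
    variation distance below eps ([contraction_tv]).

    Lower bound. Take the uniform distribution on the hub 0 and the n leaves
    e_1, ..., e_n of {0,1}^n. On functions, updating site i averages the values
    at 0 and e_i. Glauber dynamics has eigenvalues 1, 1 - 1/(2n) and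
    1/2 - 1/(2n) and mixes in 14 n steps, uniformly over the starting state
    ([star_GD_mixes]). Under a scan, whatever its order, the successive values
    at the hub solve h(N+n) = (h(N+n-1) + h(N)) / 2: in the scan order, a
    function is merely transported around a cycle of n + 1 points and slowly
    smeared out. An update loses (h(N+n-1) - h(N))^2 / 2 of squared norm, and
    these differences remain O(1/n) if the starting function is a wave of slope
    O(1/n) along the cycle. The squared norm starts at order n and loses O(1/n)
    per scan, so of the order of n^2 scans are necessary ([energy_ge],
    [star_scan_slow]), while n times the Glauber mixing time is at most
    14 n^2. *)

(** * Weighted Euclidean space of functions on a finite set *)

Section WeightedSpace.
Variables (R : realType) (m : nat) (w : 'I_m -> R).
Implicit Types (u v : 'cV[R]_m) (P : 'M[R]_m).

Definition dot u v : R := \sum_a w a * (u a 0 * v a 0).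

Definition mean v : R := \sum_a w a * v a 0.

(** Reversibility of P with respect to w. *)
Definition self_adjoint P : Prop := forall u v, dot (P *m u) v = dot u (P *m v).

Definition fixes_constants P : Prop := P *m const_mx 1 = const_mx 1 :> 'cV[R]_m.

Lemma dotC u v : dot u v = dot v u.
Proof. by apply: eq_bigr => a _; rewrite (mulrC (u a 0)). Qed.

Lemma dotDl u1 u2 v : dot (u1 + u2) v = dot u1 v + dot u2 v.
Proof.
by rewrite -big_split; apply: eq_bigr => a _; rewrite !mxE mulrDl mulrDr.
Qed.

Lemma dotZl c u v : dot (c *: u) v = c * dot u v.
Proof. by rewrite big_distrr; apply: eq_bigr => a _; rewrite !mxE /=; ring. Qed.

Lemma dotNl u v : dot (- u) v = - dot u v.
Proof. by rewrite -scaleN1r dotZl mulN1r. Qed.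

Lemma dotDr u v1 v2 : dot u (v1 + v2) = dot u v1 + dot u v2.
Proof. by rewrite dotC dotDl !(dotC u). Qed.

Lemma dotZr c u v : dot u (c *: v) = c * dot u v.
Proof. by rewrite dotC dotZl dotC. Qed.

Lemma dotNr u v : dot u (- v) = - dot u v.
Proof. by rewrite dotC dotNl dotC. Qed.

Definition dot_lin := (dotDl, dotDr, dotNl, dotNr, dotZl, dotZr).

Lemma dot_sumr n u (v : 'I_n -> 'cV[R]_m) :
  dot u (\sum_i v i) = \sum_i dot u (v i).
Proof.
elim/big_rec2: _ => [|i x y _ <-]; last by rewrite dotDr.
by rewrite -(scale0r 0) dotZr mul0r.
Qed.

Lemma mean_dot v : mean v = dot (const_mx 1) v.
Proof. by apply: eq_bigr => a _; rewrite mxE mul1r. Qed.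

Lemma reversible_self_adjoint P :
  (forall a b, w a * P a b = w b * P b a) -> self_adjoint P.
Proof.
move=> rev u v.
rewrite /dot; under eq_bigr => a _ do rewrite mxE mulr_suml mulr_sumr.
under [RHS]eq_bigr => a _ do rewrite mxE mulr_sumr mulr_sumr.
rewrite exchange_big; apply: eq_bigr => a _; apply: eq_bigr => b _.
rewrite mulrA mulrA rev; ring.
Qed.

Lemma mulmx_expr P k v : P ^+ k.+1 *m v = P ^+ k *m (P *m v).
Proof. by rewrite exprSr -mulmxE mulmxA. Qed.

Lemma mulmx_exprl P k v : P ^+ k.+1 *m v = P *m (P ^+ k *m v).
Proof. by rewrite exprS -mulmxE mulmxA. Qed.

Lemma mulmx_expr0 P v : P ^+ 0 *m v = v.
Proof. by rewrite expr0 mul1mx. Qed.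

Lemma fixes_constants_mul P Q :
  fixes_constants P -> fixes_constants Q -> fixes_constants (P * Q).
Proof. by move=> hP hQ; rewrite /fixes_constants -mulmxE -mulmxA hQ. Qed.

Lemma fixes_constants_expr P k : fixes_constants P -> fixes_constants (P ^+ k).
Proof.
move=> hP; elim: k => [|k IH]; first by rewrite /fixes_constants mulmx_expr0.
by rewrite exprS; apply: fixes_constants_mul.
Qed.

Lemma mean_invariant P v :
  self_adjoint P -> fixes_constants P -> mean (P *m v) = mean v.
Proof. by move=> sa fc; rewrite !mean_dot -sa fc. Qed.

Lemma self_adjoint_expr P k : self_adjoint P -> self_adjoint (P ^+ k).
Proof.
move=> sa; elim: k => [|k IH] u v; first by rewrite !mulmx_expr0.
by rewrite mulmx_exprl sa IH mulmx_expr.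
Qed.

Hypothesis w_gt0 : forall a, 0 < w a.

Lemma dot_ge0 u : 0 <= dot u u.
Proof.
by apply: sumr_ge0 => a _; rewrite mulr_ge0 ?(ltW (w_gt0 a)) // -expr2 sqr_ge0.
Qed.

Lemma dot_eq0 u : dot u u = 0 -> u = 0.
Proof.
move=> /eqP; rewrite psumr_eq0 => [|a _]; last first.
  by rewrite mulr_ge0 ?(ltW (w_gt0 a)) // -expr2 sqr_ge0.
move=> /allP u0; apply/matrixP => a j; rewrite ord1 !mxE.
have := u0 a; rewrite mem_index_enum => /(_ isT).
by rewrite mulf_eq0 gt_eqF //= mulf_eq0 orbb => /eqP.
Qed.

Lemma dot_ge_entry u a : w a * (u a 0) ^+ 2 <= dot u u.
Proof.
rewrite /dot (bigD1 a) //= -expr2 lerDl; apply: sumr_ge0 => b _.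
by rewrite mulr_ge0 ?(ltW (w_gt0 b)) // -expr2 sqr_ge0.
Qed.

End WeightedSpace.

(** * Total variation distance through test functions *)

Section TestFunctions.
Variables (R : realType) (m : nat) (w : 'I_m -> R).
Implicit Types (v : 'cV[R]_m) (P : 'M[R]_m).

(** The sign pattern of the difference of the two distributions is the optimal
    test function. *)
Lemma tv_test P a : exists2 s : 'cV[R]_m, (forall b, `|s b 0| <= 1) &
  dTV (P a) w = 2^-1 * ((P *m s) a 0 - mean w s).
Proof.
exists (\col_b Num.sg (P a b - w b)).
  by move=> b; rewrite mxE normr_sg; case: (_ != 0).
congr (_ * _); rewrite mxE /mean -sumrB; apply: eq_bigr => b _.
by rewrite mxE normrEsg; ring.
Qed.

Lemma test_le_tv P v M a : (forall b, `|v b 0| <= M) ->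
  `|(P *m v) a 0 - mean w v| <= 2 * M * dTV (P a) w.
Proof.
move=> vM; rewrite mxE /mean -sumrB /dTV.
have -> : 2 * M * (2^-1 * \sum_x `|P a x - w x|) = \sum_x `|P a x - w x| * M.
  by rewrite -mulr_suml; field.
apply: le_trans (ler_norm_sum _ _ _) _; apply: ler_sum => b _.
by rewrite -mulrBl normrM ler_wpM2l.
Qed.

Lemma tv_dist_le (P : 'M[R]_m) t eps : 0 <= eps ->
  (tv_dist P w t <= eps) = [forall a, dTV ((P ^+ t) a) w <= eps].
Proof.
move=> e0; apply/idP/forallP => [h a|h].
  by apply: le_trans h; apply: le_bigmax.
by apply: bigmax_le => // a _; apply: h.
Qed.

End TestFunctions.

(** * From mixing time to spectral gap *)

Section SpectralGap.
Variables (R : realType) (m : nat) (w : 'I_m -> R).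
Hypothesis w_gt0 : forall a, 0 < w a.
Implicit Types (u v f : 'cV[R]_m) (P : 'M[R]_m).

Lemma bernoulli (x : R) k : 0 <= x -> 1 + k%:R * (x - 1) <= x ^+ k.
Proof.
move=> x0; elim: k => [|k IH]; first by rewrite mul0r addr0 expr0.
rewrite exprS -[k.+1]addn1 natrD.
have h : x * (1 + k%:R * (x - 1)) <= x * x ^+ k by rewrite ler_wpM2l.
apply: le_trans h.
have : 0 <= k%:R * (x - 1) ^+ 2 by rewrite mulr_ge0 // sqr_ge0.
by lra.
Qed.

(** By the Bernoulli inequality, powers of a number above 1 are unbounded. *)
Lemma bounded_powers (x K : R) : (forall k, x ^+ k <= K) -> x <= 1.
Proof.
move=> h; rewrite leNgt; apply/negP => x1.
have d0 : 0 < x - 1 by rewrite subr_gt0.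
have K0 : 0 <= K by apply: le_trans (h 0%N); rewrite expr0.
have := h (Num.truncn (K / (x - 1))).+1.
have := @bernoulli x (Num.truncn (K / (x - 1))).+1 (le_trans ler01 (ltW x1)).
have : K / (x - 1) < (Num.truncn (K / (x - 1))).+1%:R by apply: truncnS_gt.
rewrite ltr_pdivrMr // => a b c; lra.
Qed.

(** Halving the exponent by self-adjointness leaves either a squared norm or the
    quadratic form of P. *)
Lemma psd_expr P k f : self_adjoint w P -> (forall u, 0 <= dot w u (P *m u)) ->
  0 <= dot w f (P ^+ k *m f).
Proof.
move=> sa psd; have [j] := ubnP k; elim: j k f => // j IH [|[|k]] f lkj.
- by rewrite mulmx_expr0 dot_ge0.
- by rewrite expr1.
- by rewrite mulmx_exprl -sa mulmx_expr IH // -ltnS ltnW.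
Qed.

(** The moments are log-convex, by positivity of all powers of P; so the ratio of
    consecutive moments never drops below the first one, rho. *)
Lemma moment_ge P f k (rho := dot w f (P *m f) / dot w f f) :
  self_adjoint w P -> (forall u, 0 <= dot w u (P *m u)) -> f != 0 ->
  rho ^+ k * dot w f f <= dot w f (P ^+ k *m f).
Proof.
move=> sa psd f0.
have ff0 : 0 < dot w f f.
  rewrite lt_neqAle dot_ge0 // andbT eq_sym; apply: contra f0 => /eqP e.
  by apply/eqP; apply: (dot_eq0 w_gt0).
have rho0 : 0 <= rho by rewrite divr_ge0 // ltW.
pose a j := dot w f (P ^+ j *m f).
have a2 j : 0 <= a j.+2 - 2 * rho * a j.+1 + rho ^+ 2 * a j.
  have := psd_expr j (P *m f - rho *: f) sa psd.
  rewrite mulmxBr -scalemxAr -mulmx_expr !dot_lin !sa -!mulmx_exprl.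
  by rewrite /a; lra.
have step j : rho * a j <= a j.+1.
  elim: j => [|j IH].
    by rewrite /a expr1 mulmx_expr0 /rho divfK // gt_eqF.
  have : rho * (a j.+1 - rho * a j) >= 0 by rewrite mulr_ge0 // subr_ge0.
  have := a2 j; lra.
elim: k => [|k IH]; first by rewrite expr0 mul1r mulmx_expr0.
by apply: le_trans (step k); rewrite exprS -mulrA ler_wpM2l.
Qed.

Hypothesis w_sum1 : \sum_a w a = 1.

(** A mean-zero f stays mean-zero, so that each further T steps bring every value
    of f within 2 * (1/4) * sup |f| of 0. *)
Lemma halving P f T k M : self_adjoint w P -> fixes_constants P ->
  tv_dist P w T <= 1 / 4 -> mean w f = 0 -> (forall a, `|f a 0| <= M) ->
  forall a, `|(P ^+ (T * k) *m f) a 0| <= M / 2 ^+ k.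
Proof.
move=> sa fc; rewrite tv_dist_le // => /forallP tv mf fM.
elim: k => [|k IH] a; first by rewrite muln0 mulmx_expr0 expr0 divr1.
have mk : mean w (P ^+ (T * k) *m f) = 0.
  by rewrite mean_invariant ?mf //;
    [apply: self_adjoint_expr | apply: fixes_constants_expr].
have := test_le_tv w (P ^+ T) a IH.
rewrite mk subr0 mulmxA mulmxE -exprD -mulnS => /le_trans; apply.
have Mk : 0 <= M / 2 ^+ k by apply: le_trans (IH a).
have := ler_wpM2l Mk (tv a); rewrite exprS invfM; lra.
Qed.

(** Sup-norm halving forces rho^(T k) <= K 2^-k for all k, with rho the Rayleigh
    quotient of f and K independent of k; hence 2 rho^T <= 1, and the Bernoulli
    inequality gives T (1 - rho) >= 1/2. Comparing growth rates in k makes the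
    ratio of sup norm to L2 norm, which could cost a factor log(1 / pi_min),
    disappear. *)
Lemma spectral_gap P f T : self_adjoint w P -> fixes_constants P ->
  (forall u, 0 <= dot w u (P *m u)) ->
  (0 < T)%N -> tv_dist P w T <= 1 / 4 -> mean w f = 0 ->
  dot w f f <= 2 * T%:R * (dot w f f - dot w f (P *m f)).
Proof.
move=> sa fc psd T0 tv mf.
have [->|f0] := eqVneq f 0.
  by rewrite mulmx0 -(scale0r 0) dotZl !mul0r subrr mulr0.
have ff0 : 0 < dot w f f.
  rewrite lt_neqAle dot_ge0 // andbT eq_sym; apply: contra f0 => /eqP e.
  by apply/eqP; apply: (dot_eq0 w_gt0).
pose rho := dot w f (P *m f) / dot w f f.
have rho0 : 0 <= rho by rewrite divr_ge0 // ltW.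
pose M : R := \sum_a `|f a 0|.
have fM a : `|f a 0| <= M by rewrite /M (bigD1 a) //= lerDl sumr_ge0.
have M0 : 0 <= M by apply: sumr_ge0.
have small : 2 * rho ^+ T <= 1.
  apply: (@bounded_powers _ (M ^+ 2 / dot w f f)) => k.
  rewrite ler_pdivlMr // exprMn -exprM.
  have := @moment_ge P f (T * k) sa psd f0; rewrite -/rho => mom.
  have up : dot w f (P ^+ (T * k) *m f) <= M ^+ 2 / 2 ^+ k.
    have -> : M ^+ 2 / 2 ^+ k = \sum_a w a * (M ^+ 2 / 2 ^+ k).
      by rewrite -mulr_suml w_sum1 mul1r.
    apply: ler_sum => a _; rewrite ler_wpM2l ?(ltW (w_gt0 a)) //.
    apply: le_trans (ler_norm _) _; rewrite normrM expr2 -mulrA.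
    by rewrite ler_pM // (halving k sa fc tv mf).
  have := le_trans mom up; rewrite ler_pdivlMr ?exprn_gt0 //.
  by move=> h; rewrite -mulrA mulrC.
have := bernoulli T rho0.
have -> : dot w f (P *m f) = rho * dot w f f by rewrite divfK // gt_eqF.
move=> b.
have : 1 <= 2 * T%:R * (1 - rho) by lra.
move=> /(ler_wpM2r (ltW ff0)); lra.
Qed.

End SpectralGap.

(** * Composing orthogonal projections *)

Section ProjectionSweep.
Variables (R : realType) (m : nat) (w : 'I_m -> R).
Hypothesis w_gt0 : forall a, 0 < w a.
Implicit Types (u v f g : 'cV[R]_m) (P Q : 'M[R]_m).

Definition orth_proj P : Prop := self_adjoint w P /\ P *m P = P.

Lemma orth_proj_dot P f : orth_proj P ->
  dot w (P *m f) (P *m f) = dot w f (P *m f).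
Proof. by case=> sa idem; rewrite sa mulmxA idem. Qed.

Lemma orth_proj_loss P f : orth_proj P ->
  dot w (f - P *m f) (f - P *m f) = dot w f f - dot w (P *m f) (P *m f).
Proof.
by move=> pP; rewrite !dot_lin orth_proj_dot // (dotC _ (P *m f) f); ring.
Qed.

Lemma orth_proj_nearest P f g : orth_proj P ->
  dot w (f - P *m f) (f - P *m f) <= dot w (f - P *m g) (f - P *m g).
Proof.
move=> pP; have -> : f - P *m g = (f - P *m f) + P *m (f - g).
  by rewrite mulmxBr addrA subrK.
set d := f - P *m f; set h := P *m (f - g).
have orth : dot w d h = 0.
  case: pP => sa idem.
  by rewrite /h -sa mulmxBr mulmxA idem subrr -(scale0r 0) dotZl mul0r.
move: d h orth => d h orth.
by rewrite [leRHS]dotDl !dotDr (dotC _ h d) orth addr0 add0r lerDl dot_ge0.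
Qed.

Variable B : nat -> 'M[R]_m.
Hypothesis projB : forall k, orth_proj (B k).

Fixpoint sweep k : 'M[R]_m := if k is j.+1 then B j * sweep j else 1.

Lemma sweepS k f : sweep k.+1 *m f = B k *m (sweep k *m f).
Proof. by rewrite mulmxA mulmxE. Qed.

(** By the Pythagorean identity this is the sum of the squared lengths of the
    first k steps; see [lossS]. *)
Definition loss k f := dot w f f - dot w (sweep k *m f) (sweep k *m f).

Lemma lossS k f : loss k.+1 f = loss k f +
  dot w (sweep k *m f - sweep k.+1 *m f) (sweep k *m f - sweep k.+1 *m f).
Proof. by rewrite /loss sweepS orth_proj_loss //; ring. Qed.

Lemma loss0 f : loss 0 f = 0.
Proof. by rewrite /loss mul1mx subrr. Qed.

Lemma loss_mono f k l : (k <= l)%N -> loss k f <= loss l f.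
Proof.
move=> /subnK <-; elim: (l - k)%N => // j; rewrite addSn lossS => /le_trans; apply.
by rewrite lerDl dot_ge0.
Qed.

Lemma loss_ge0 k f : 0 <= loss k f.
Proof. by rewrite -(loss0 f) loss_mono. Qed.

(** Convexity of the square, in the form used to bound the square of a sum of
    k + 1 vectors by k + 1 times the sum of their squares. *)
Lemma sqr_add_le k u v (E : R) : 0 <= E -> dot w u u <= k%:R * E ->
  dot w (u + v) (u + v) <= k.+1%:R * (E + dot w v v).
Proof.
case: k => [|k] E0 uu.
  have -> : u = 0.
    apply: (dot_eq0 w_gt0); apply/eqP.
    by rewrite eq_le dot_ge0 // andbT -(mul0r E).
  by rewrite add0r mul1r lerDr.
set x : R := k.+1%:R in uu *.
have x0 : 0 < x by rewrite ltr0n.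
have -> : k.+2%:R = x + 1 :> R by rewrite -[k.+2]addn1 natrD.
have := dot_ge0 w_gt0 (u - x *: v).
rewrite !dot_lin (dotC w v u) => h.
rewrite -(ler_pM2l x0).
have := ler_wpM2l (ltW x0) uu.
nra.
Qed.

(** The displacement after k steps is a sum of k steps, whose squared lengths add
    up to the loss. *)
Lemma drift_le_loss k f :
  dot w (f - sweep k *m f) (f - sweep k *m f) <= k%:R * loss k f.
Proof.
elim: k => [|k IH]; first by rewrite mul1mx subrr -(scale0r 0) dotZl !mul0r.
have -> : f - sweep k.+1 *m f =
  (f - sweep k *m f) + (sweep k *m f - sweep k.+1 *m f) by rewrite addrA subrK.
by rewrite lossS; apply: sqr_add_le => //; apply: loss_ge0.
Qed.

(** The range of B k contains the point reached after step k + 1, so B k moves f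
    no further than the first k + 1 steps of the sweep did. *)
Lemma sweep_loss n f :
  \sum_(k < n) dot w (f - B k *m f) (f - B k *m f) <= n%:R ^+ 2 * loss n f.
Proof.
have -> : n%:R ^+ 2 * loss n f = \sum_(k < n) n%:R * loss n f.
  by rewrite sumr_const card_ord -[RHS]mulr_natl mulrA expr2.
apply: ler_sum => k _.
apply: le_trans (orth_proj_nearest f (sweep k *m f) (projB k)) _.
rewrite -sweepS; apply: le_trans (drift_le_loss _ _) _.
by rewrite ler_pM ?ler_nat ?loss_ge0 ?loss_mono.
Qed.

End ProjectionSweep.

Section SweepProduct.
Variables (R : realType) (m : nat).

(** A sweep is indexed by all natural numbers so that it can be cut at any point;
    beyond n the projections are padded with the identity. *)
Lemma prod_rev_sweep n (A : 'I_n -> 'M[R]_m) :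
  \prod_(i < n) A (rev_ord i) =
  sweep (fun k => if insub k is Some i then A i else 1) n.
Proof.
set B := (X in sweep X).
have -> : \prod_(i < n) A (rev_ord i) = \prod_(i < n) B (n - i.+1)%N.
  apply: eq_bigr => i _; rewrite /B; case: insubP => [j _ ji|].
    by congr A; apply: val_inj; rewrite ji.
  by rewrite ltn_subrL (leq_ltn_trans _ (ltn_ord i)).
move: B => C; elim: n {A} C => [|n IH] C; first by rewrite big_ord0.
by rewrite big_ord_recl /= subn1 -IH.
Qed.

End SweepProduct.

(** * From one scan to total variation *)

Section ScanDecay.
Variables (R : realType) (m : nat) (w : 'I_m -> R).
Hypothesis w_gt0 : forall a, 0 < w a.
Hypothesis w_sum1 : \sum_a w a = 1.

Lemma mean_const c : mean w (const_mx c) = c.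
Proof.
rewrite /mean; under eq_bigr do rewrite mxE.
by rewrite -mulr_suml w_sum1 mul1r.
Qed.

Lemma const_mx_scale (c : R) : const_mx c = c *: const_mx 1 :> 'cV[R]_m.
Proof. by apply/matrixP => i j; rewrite !mxE mulr1. Qed.

Lemma meanB u v : mean w (u - v) = mean w u - mean w v.
Proof. by rewrite !mean_dot !dot_lin. Qed.

(** Centering the test function for the starting point a gives a mean-zero
    function of norm at most 1, whose value at a after t steps is twice the
    distance. The weight w a is the price for evaluating at a point. *)
Lemma contraction_tv (S : 'M[R]_m) (r : R) t a : 0 <= r -> fixes_constants S ->
  (forall f, mean w (S *m f) = mean w f) ->
  (forall f, mean w f = 0 -> dot w (S *m f) (S *m f) <= r * dot w f f) ->
  w a * (dTV ((S ^+ t) a) w) ^+ 2 <= r ^+ t.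
Proof.
move=> r0 fc mS contr.
have [s s1 ->] := tv_test w (S ^+ t) a.
pose g := s - const_mx (mean w s).
have mg : mean w g = 0 by rewrite meanB mean_const subrr.
have mSg k : mean w (S ^+ k *m g) = 0.
  by elim: k => [|k IH]; rewrite ?mulmx_expr0 // mulmx_exprl mS.
have decay k : dot w (S ^+ k *m g) (S ^+ k *m g) <= r ^+ k * dot w g g.
  elim: k => [|k IH]; first by rewrite mulmx_expr0 mul1r.
  rewrite mulmx_exprl exprS -mulrA; apply: le_trans (contr _ (mSg k)) _.
  by rewrite ler_wpM2l.
have Sg : (S ^+ t *m g) a 0 = (S ^+ t *m s) a 0 - mean w s.
  rewrite /g const_mx_scale.
  rewrite mulmxBr -scalemxAr (fixes_constants_expr t fc).
  by rewrite !mxE mulr1.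
have gg : dot w g g <= 1.
  have -> : dot w g g = dot w s s - (mean w s) ^+ 2.
    rewrite /g const_mx_scale.
    rewrite !dot_lin (dotC _ s (const_mx 1)) -!mean_dot mean_const; ring.
  rewrite lerBlDr; apply: (@le_trans _ _ 1); last by rewrite lerDl sqr_ge0.
  rewrite -w_sum1; apply: ler_sum => b _; rewrite -[leRHS]mulr1.
  rewrite ler_wpM2l ?(ltW (w_gt0 b)) // -expr2 -real_normK ?num_real //.
  by rewrite expr_le1.
rewrite -Sg; have := dot_ge_entry w_gt0 (S ^+ t *m g) a.
have := decay t; have := ler_wpM2l (exprn_ge0 t r0) gg.
have := dot_ge0 w_gt0 (S ^+ t *m g).
rewrite mulr1 exprMn; nra.
Qed.

(** The left side of [sweep_loss] is n times the Dirichlet form of f for Glauber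
    dynamics, which does not depend on the order of the sites. *)
Lemma scan_contraction n (A : 'I_n -> 'M[R]_m) (s : {perm 'I_n}) T f
  (S := \prod_(i < n) A (s (rev_ord i))) :
  (0 < n)%N -> (0 < T)%N ->
  (forall i, orth_proj w (A i)) -> (forall i, fixes_constants (A i)) ->
  tv_dist (n%:R^-1 *: \sum_(i < n) A i) w T <= 1 / 4 -> mean w f = 0 ->
  dot w (S *m f) (S *m f) <= (1 - (2 * T%:R * n%:R)^-1) * dot w f f.
Proof.
move=> n0 T0 pA fA tv mf.
have nR : 0 < n%:R :> R by rewrite ltr0n.
have TR : 0 < T%:R :> R by rewrite ltr0n.
set P := n%:R^-1 *: \sum_(i < n) A i in tv.
have PE u : P *m u = n%:R^-1 *: \sum_i A i *m u by rewrite -scalemxAl mulmx_suml.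
have saP : self_adjoint w P.
  move=> u v; rewrite !PE dotC !dotZr !dot_sumr; congr (_ * _).
  by apply: eq_bigr => i _; rewrite dotC; case: (pA i) => ->.
have fcP : fixes_constants P.
  rewrite /fixes_constants PE; under eq_bigr do rewrite fA.
  by rewrite sumr_const card_ord -scaler_nat scalerA mulVf ?scale1r // gt_eqF.
have psdP u : 0 <= dot w u (P *m u).
  rewrite PE dotZr dot_sumr mulr_ge0 ?invr_ge0 ?(ltW nR) //.
  apply: sumr_ge0 => i _.
  by rewrite -orth_proj_dot // dot_ge0.
have gap := spectral_gap w_gt0 w_sum1 saP fcP psdP T0 tv mf.
pose B k : 'M[R]_m := if insub k is Some i then A (s i) else 1.
have pB k : orth_proj w (B k).
  rewrite /B; case: insub => [i|]; first exact: pA.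
  by split=> [u v|]; rewrite ?mul1mx.
have SE : S = sweep B n by rewrite /S (prod_rev_sweep (fun i => A (s i))).
have := sweep_loss w_gt0 pB n f; rewrite /loss -SE.
have -> : \sum_(k < n) dot w (f - B k *m f) (f - B k *m f) =
          n%:R * (dot w f f - dot w f (P *m f)).
  rewrite PE dotZr mulrBr mulrA divff ?gt_eqF // mul1r dot_sumr.
  have -> : n%:R * dot w f f = \sum_(i < n) dot w f f.
    by rewrite sumr_const card_ord mulr_natl.
  rewrite -sumrB [RHS](reindex_inj (@perm_inj _ s)); apply: eq_bigr => i _.
  by rewrite orth_proj_loss /B valK ?orth_proj_dot.
rewrite expr2 -mulrA ler_pM2l // => lo.
have : dot w f f <= 2 * T%:R * n%:R * (dot w f f - dot w (S *m f) (S *m f)).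
  apply: le_trans gap _; rewrite -[leRHS]mulrA ler_wpM2l //.
have c0 : 0 < 2 * T%:R * n%:R :> R by rewrite !mulr_gt0.
rewrite -ler_pdivrMl //; lra.
Qed.

End ScanDecay.

(** * Bounding mixing times *)

Section MixingTimes.
Variables (R : realType) (m : nat) (P : 'M[R]_m) (w : 'I_m -> R).

Lemma tmix_le eps t : tv_dist P w t <= eps -> (tmix P w eps <= t%:R%:E)%E.
Proof.
move=> h; rewrite /tmix; case: pselect => [ex|nex]; last by case: nex; exists t.
by case: ex_minnP => k _ /(_ t h) kt; rewrite lee_fin ler_nat.
Qed.

Lemma tmix_ge eps (b : R) : (forall t, tv_dist P w t <= eps -> b <= t%:R) ->
  (b%:E <= tmix P w eps)%E.
Proof.
move=> h; rewrite /tmix; case: pselect => [ex|_]; last by rewrite leey.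
by case: ex_minnP => k /h kb _; rewrite lee_fin.
Qed.

Lemma tmixP eps : (exists2 t, tv_dist P w t <= eps & tmix P w eps = t%:R%:E) \/
  tmix P w eps = +oo%E.
Proof.
rewrite /tmix; case: pselect => [ex|_]; last by right.
by left; case: ex_minnP => k hk _; exists k.
Qed.

End MixingTimes.

(** If the chain were 1/4-mixed at time 0, then w >= 3/4 at every state, which is
    possible for one state only. *)
Lemma start_not_mixed (R : realType) m (P : 'M[R]_m) (w : 'I_m -> R) t
    (a b : 'I_m) :
  (forall a, 0 < w a) -> \sum_a w a = 1 -> a != b ->
  tv_dist P w t <= 1 / 4 -> (0 < t)%N.
Proof.
move=> w0 w1 ab; case: t => //; rewrite tv_dist_le // => /forallP tv.
have big c : 3 / 4 <= w c.
  pose v : 'cV[R]_m := \col_d (2 * (d == c)%:R - 1).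
  have v1 d : `|v d 0| <= 1.
    rewrite mxE ler_norml; case: eqP => _ /=; rewrite ?mulr1n ?mulr0n;
      by apply/andP; split; lra.
  have := test_le_tv w (P ^+ 0) c v1; rewrite mulmx_expr0 [v c 0]mxE eqxx.
  have -> : mean w v = 2 * w c - 1.
    rewrite /mean -[X in _ - X]w1 (bigD1 c) //= mxE eqxx mulr1n [in RHS](bigD1 c) //=.
    rewrite (eq_bigr (fun d => - w d)) => [|d /negPf dc]; last first.
      by rewrite mxE dc mulr0n; ring.
    by rewrite sumrN; ring.
  have := tv c; have := ler_norm (2 * 1%:R - 1 - (2 * w c - 1)); lra.
have := w1; rewrite (bigD1 a) //= (bigD1 b) 1?eq_sym //=.
set r := (X in _ + (_ + X) = 1).
have : 0 <= r by apply: sumr_ge0 => c _; apply/ltW.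
have := big a; have := big b; lra.
Qed.

(** * Site updates are orthogonal projections *)

Section SiteKernels.
Variables (R : realType) (n : nat) (X : 'I_n -> finType) (pi : config X -> R).
Hypothesis pi_distr : is_distr pi.
Implicit Types (x y z : config X) (i : 'I_n).
Notation w := (stat pi).

Lemma stat_gt0 a : 0 < w a.
Proof.
case: pi_distr => p0 _; have := enum_valP a; rewrite inE lt_neqAle eq_sym => ->.
exact: p0.
Qed.

(** The conditional expectations are sums over all configurations, the chains
    live on the support. *)
Lemma sum_supp (Q : pred (config X)) (F : config X -> R) :
  \sum_(z | Q z) pi z * F z =
  \sum_(b < #|supp pi| | Q (enum_val b)) w b * F (enum_val b).
Proof.
rewrite /stat -(big_enum_val_cond Q (fun z => pi z * F z)).
rewrite [LHS](bigID (mem (supp pi))) /=.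
rewrite [X in _ + X]big1 ?addr0 => [|z /andP[_]].
  by apply: eq_bigl => z; rewrite andbC.
by rewrite inE negbK => /eqP ->; rewrite mul0r.
Qed.

Lemma stat_sum1 : \sum_a w a = 1.
Proof.
case: pi_distr => _ <-; have := sum_supp xpredT (fun=> 1).
by under eq_bigr do rewrite mulr1; under [in RHS]eq_bigr do rewrite mulr1.
Qed.

Lemma agree_off_refl i x : agree_off i x x.
Proof. by apply/forallP => j; rewrite eqxx implybT. Qed.

Lemma agree_off_sym i x y : agree_off i x y = agree_off i y x.
Proof. by apply: eq_forallb => j; rewrite [x j == _]eq_sym. Qed.

Lemma agree_off_trans i x y z :
  agree_off i x y -> agree_off i y z -> agree_off i x z.
Proof.
move=> /forallP h1 /forallP h2; apply/forallP => j; apply/implyP => ji.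
by have := h1 j; have := h2 j; rewrite ji /= => /eqP <-.
Qed.

Lemma agree_off_eqr i x y z :
  agree_off i x y -> agree_off i x z = agree_off i y z.
Proof.
move=> xy; apply/idP/idP => [xz|]; last exact: agree_off_trans.
by apply: (agree_off_trans _ xz); rewrite agree_off_sym.
Qed.

Let same i (a b : 'I_#|supp pi|) := agree_off i (enum_val a) (enum_val b).
Let mass i a : R := \sum_(b | same i a b) w b.

Lemma P_site_mulE i (v : 'cV[R]_#|supp pi|) a :
  (P_site pi i *m v) a 0 = (\sum_(b | same i a b) w b * v b 0) / mass i a.
Proof.
have [x xS] : exists x, x \in supp pi by exists (enum_val a); apply: enum_valP.
pose f y := v (enum_rank_in xS y) 0.
have -> : v = \col_b f (enum_val b).
  by apply/matrixP => b j; rewrite mxE ord1 /f enum_valK_in.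
rewrite P_siteE /cond_exp sum_supp; congr (_ / _).
  by apply: eq_bigr => b _; rewrite mxE.
have := sum_supp (agree_off i (enum_val a)) (fun=> 1).
by under eq_bigr do rewrite mulr1; under [in RHS]eq_bigr do rewrite mulr1.
Qed.

Lemma mass_gt0 i a : 0 < mass i a.
Proof.
rewrite /mass (bigD1 a) /=; last exact: agree_off_refl.
rewrite ltr_pwDl ?stat_gt0 // sumr_ge0 // => b _; exact/ltW/stat_gt0.
Qed.

Lemma mass_same i a b : same i a b -> mass i a = mass i b.
Proof. by move=> ab; apply: eq_bigl => c; rewrite /same (agree_off_eqr _ ab). Qed.

Lemma P_siteEentry i a b :
  P_site pi i a b = if same i a b then w b / mass i a else 0.
Proof.
have -> : P_site pi i a b = (P_site pi i *m (delta_mx b 0 : 'cV_#|supp pi|)) a 0.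
  rewrite [RHS]mxE (bigD1 b) //= [delta_mx _ _ _ _]mxE !eqxx mulr1 big1 ?addr0 //.
  by move=> c /negPf cb; rewrite [delta_mx _ _ _ _]mxE cb mulr0.
rewrite P_site_mulE; case: ifP => ab.
  congr (_ / _); rewrite (bigD1 b) //= mxE !eqxx mulr1 big1 ?addr0 //.
  by move=> c /andP[_ /negPf cb]; rewrite mxE cb mulr0.
rewrite big1 ?mul0r // => c ac; rewrite mxE; case: eqP => [cb|]; rewrite ?mulr0 //.
by rewrite -cb ac in ab.
Qed.

Lemma P_site_orth_proj i : orth_proj w (P_site pi i).
Proof.
split.
  apply: reversible_self_adjoint => a b; rewrite !P_siteEentry.
  rewrite /same agree_off_sym -/(same i b a); case: ifP => [ba|]; last by rewrite !mulr0.
  by rewrite (mass_same ba) mulrCA.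
apply/matrixP => a c.
have -> : (P_site pi i *m P_site pi i) a c =
    (P_site pi i *m col c (P_site pi i)) a 0.
  by rewrite [LHS]mxE [RHS]mxE; apply: eq_bigr => b _; rewrite [col _ _ _ _]mxE.
rewrite P_site_mulE; set k := P_site pi i a c.
have -> : \sum_(b | same i a b) w b * col c (P_site pi i) b 0 =
          \sum_(b | same i a b) w b * k.
  apply: eq_bigr => b ab; rewrite [col _ _ _ _]mxE /k !P_siteEentry (mass_same ab).
  by rewrite /same (agree_off_eqr _ ab).
by rewrite -mulr_suml mulrAC divff ?mul1r // gt_eqF // mass_gt0.
Qed.

Lemma P_site_fixes i : fixes_constants (P_site pi i).
Proof.
apply/matrixP => a j; rewrite ord1 P_site_mulE mxE.
under eq_bigr do rewrite mxE mulr1.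
by rewrite divff // gt_eqF // mass_gt0.
Qed.

Lemma P_SS_fixes sigma : fixes_constants (P_SS pi sigma).
Proof.
apply: (big_ind (@fixes_constants _ _)) => [|P Q|i _].
- by rewrite /fixes_constants mul1mx.
- exact: fixes_constants_mul.
- exact: P_site_fixes.
Qed.

Lemma P_SS_mean sigma f : mean w (P_SS pi sigma *m f) = mean w f.
Proof.
rewrite /P_SS; elim/big_rec: _ f => [|i S _ IH] f; first by rewrite mul1mx.
rewrite -mulmxE -mulmxA mean_invariant ?IH //; last exact: P_site_fixes.
by case: (P_site_orth_proj (sigma (rev_ord i))).
Qed.

Lemma pi_min_le a : pi_min pi <= w a.
Proof. exact: (bigmin_le_cond _ _ (enum_valP a)). Qed.

Lemma pi_min_gt0 : 0 < pi_min pi.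
Proof.
apply: lt_bigmin => // x xS.
case: pi_distr => p0 _; move: xS; rewrite inE lt_neqAle eq_sym => ->; exact: p0.
Qed.

Lemma pi_min_le1 : pi_min pi <= 1.
Proof. exact: bigmin_le_id. Qed.

Lemma two_states (a b : 'I_#|supp pi|) : a != b -> pi_min pi <= 1 / 2.
Proof.
move=> ab; have := stat_sum1; rewrite (bigD1 a) //= (bigD1 b) 1?eq_sym //=.
have := pi_min_le a; have := pi_min_le b.
set r := (X in _ + (_ + X) = 1).
have : 0 <= r by apply: sumr_ge0 => c _; apply/ltW/stat_gt0.
lra.
Qed.

End SiteKernels.

(** * Upper bound for systematic scan *)

Section ScanUpperBound.
Variables (R : realType).

Lemma ln_inv_ge (x : R) : 0 < x -> 1 - x <= ln (1 / x).
Proof.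
move=> x0; rewrite div1r lnV ?posrE //; have := expR_ge1Dx (ln x).
rewrite lnK ?posrE //; lra.
Qed.

Lemma scan_tmix_le (n : nat) (X : 'I_n -> finType) (pi : config X -> R)
    (sigma : {perm 'I_n}) eps : is_distr pi -> (0 < n)%N -> 0 < eps -> eps <= 1 ->
  (tmix_SS pi sigma eps <=
     (8 * n%:R)%:E * tmix_GD pi (1 / 4) * (ln (1 / (eps * pi_min pi)))%:E)%E.
Proof.
move=> dpi n0 e0 e1.
have w0 := stat_gt0 dpi; have w1 := stat_sum1 dpi.
have p0 := pi_min_gt0 dpi; have p1 := pi_min_le1 pi.
set L := ln _.
have ep0 : 0 < eps * pi_min pi by rewrite mulr_gt0.
have L0 : 0 <= L.
  apply: le_trans (ln_inv_ge ep0); rewrite subr_ge0 mulr_ile1 //; exact: ltW.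
have nR : 0 < n%:R :> R by rewrite ltr0n.
(* On a one-point support the right side may be 0, which leaves no room for
   rounding a time up to an integer; but there the scan is mixed at time 0. *)
have [[a [b ab]]|one] := pselect (exists a b : 'I_#|supp pi|, a != b); last first.
  have eqI a b : a = b :> 'I_#|supp pi|.
    by apply/eqP/negPn/negP => h; apply: one; exists a, b.
  apply: (@le_trans _ _ 0%E).
    apply: (@tmix_le _ _ _ _ _ 0); rewrite tv_dist_le ?ltW //.
    apply/forallP => a; rewrite /dTV big1 ?mulr0 ?ltW // => b _.
    have := w1; rewrite (bigD1 b) //= big1 => [|c]; last by rewrite (eqI c b) eqxx.
    by rewrite addr0 => ->; rewrite expr0 mxE (eqI a b) eqxx subrr normr0.
  apply: mule_ge0; last by rewrite lee_fin.
  apply: mule_ge0; first by rewrite lee_fin mulr_ge0 // ltW.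
  by apply: tmix_ge => t _; rewrite ler0n.
have pi2 := two_states dpi ab.
have L2 : 1 / 2 <= L.
  apply: le_trans (ln_inv_ge ep0).
  have : eps * pi_min pi <= pi_min pi by rewrite ler_piMl // ltW.
  lra.
rewrite /tmix_GD.
case: (tmixP (P_GD pi) (stat pi) (1 / 4)) => [[T tvT ->]|->]; last first.
  rewrite gt0_muley ?lte_fin ?mulr_gt0 // gt0_mulye ?leey // lte_fin; lra.
have T0 : (0 < T)%N := start_not_mixed w0 w1 ab tvT.
have TR : 1 <= T%:R :> R by rewrite ler1n.
have n1 : 1 <= n%:R :> R by rewrite ler1n.
(* With d := 1 / (2 T n), (1 - d)^t <= exp(- 2 L) = (eps * pi_min)^2 as soon as
   t >= 2 L / d. Since L >= 1/2, the constant 8 absorbs the rounding. *)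
set t := (Num.truncn (4 * n%:R * T%:R * L)).+1.
have t_gt : 4 * n%:R * T%:R * L < t%:R by apply: truncnS_gt.
have nT1 : 1 <= n%:R * T%:R :> R by rewrite -natrM ler1n muln_gt0 n0.
have nTL : 1 / 2 <= n%:R * T%:R * L.
  by apply: le_trans L2 _; rewrite ler_peMl.
have t_le : t%:R <= 8 * n%:R * T%:R * L.
  have : (Num.truncn (4 * n%:R * T%:R * L))%:R <= 4 * n%:R * T%:R * L.
    have /truncn_itv/andP[] // : 0 <= 4 * n%:R * T%:R * L by rewrite !mulr_ge0.
  by rewrite /t -addn1 natrD; lra.
move: t t_gt t_le => t t_gt t_le.
apply: (@le_trans _ _ t%:R%:E); last by rewrite -!EFinM lee_fin.
apply: tmix_le; rewrite tv_dist_le ?ltW //; apply/forallP => c.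
set d : R := (2 * T%:R * n%:R)^-1.
have c0 : 0 < 2 * T%:R * n%:R :> R by lra.
have d1 : 0 <= 1 - d by rewrite subr_ge0 invf_le1 //; lra.
have := @contraction_tv _ _ _ w0 w1 (P_SS pi sigma) (1 - d) t c d1
  (P_SS_fixes dpi sigma) (P_SS_mean dpi sigma).
move=> /(_ (fun f => @scan_contraction _ _ _ w0 w1 _ _ sigma T f n0 T0
  (P_site_orth_proj dpi) (P_site_fixes dpi) tvT)) tv.
have small : (1 - d) ^+ t <= (eps * pi_min pi) ^+ 2.
  have -> : eps * pi_min pi = expR (- L).
    by rewrite /L div1r lnV ?posrE // opprK lnK ?posrE.
  apply: (@le_trans _ _ (expR (- d) ^+ t)).
    by rewrite lerXn2r ?nnegrE ?expR_ge0 // expR_ge1Dx.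
  have dt : 2 * L <= t%:R * d by rewrite /d ler_pdivlMr //; lra.
  by rewrite -(expRM_natl t (- d)) -(expRM_natl 2 (- L)) ler_expR !mulrN lerN2.
have tv0 : 0 <= dTV ((P_SS pi sigma ^+ t) c) (stat pi).
  by rewrite mulr_ge0 // sumr_ge0.
rewrite -(ler_sqr tv0 (ltW e0)) -(ler_pM2l p0).
apply: (@le_trans _ _ (stat pi c * dTV ((P_SS pi sigma ^+ t) c) (stat pi) ^+ 2)).
  by rewrite ler_wpM2r ?sqr_ge0 ?pi_min_le.
apply: le_trans tv _; apply: le_trans small _; rewrite exprMn mulrC expr2.
by rewrite -mulrA ler_pM2l // ler_piMl // ?sqr_ge0.
Qed.

End ScanUpperBound.

(** * The recurrence h(N+n) = (h(N+n-1) + h(N)) / 2 *)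

Section AveragingRecurrence.
Variables (R : realType) (p : nat).

(** Iterating the shift of a window of p + 1 values that appends the average of
    its two ends. *)
Lemma averaging_solution (x : nat -> R) : exists2 h : nat -> R,
  forall j, (j <= p)%N -> h j = x j &
  forall N, h (N + p.+1)%N = (h (N + p)%N + h N) / 2.
Proof.
pose step (y : nat -> R) j := if (j < p)%N then y j.+1 else (y p + y 0%N) / 2.
pose h N := iter N step x 0%N.
have shift N j : (j <= p)%N -> iter N step x j = h (N + j)%N.
  elim: j N => [|j IH] N jp; first by rewrite addn0.
  by rewrite addnS -addSn -IH ?(ltnW jp) //= /step jp.
exists h => [j jp|N]; first by rewrite -[j]add0n -shift.
by rewrite addnS -addSn -shift //= {1}/step ltnn shift // shift // addn0.
Qed.

Variable h : nat -> R.
Hypothesis h_rec : forall N, h (N + p.+1)%N = (h (N + p)%N + h N) / 2.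

(** The difference of the two values about to be averaged. *)
Definition jump N := h (N + p)%N - h N.

(** The squared norm, centered at c, of the function on the star whose leaves
    carry the current window; the hub has the value of the last updated leaf,
    which is therefore counted twice. *)
Definition energy c N :=
  (h (N + p)%N - c) ^+ 2 + \sum_(j < p.+1) (h (N + j)%N - c) ^+ 2.

Lemma energyS c N : energy c N.+1 = energy c N - jump N ^+ 2 / 2.
Proof.
have sums : (h N - c) ^+ 2 + \sum_(j < p.+1) (h (N.+1 + j)%N - c) ^+ 2 =
    \sum_(j < p.+1) (h (N + j)%N - c) ^+ 2 + (h (N + p.+1)%N - c) ^+ 2.
  rewrite -(big_ord_recr p.+1 (fun j => (h (N + j)%N - c) ^+ 2)) big_ord_recl /=.
  rewrite addn0; congr (_ + _); apply: eq_bigr => j _.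
  by rewrite /bump leq0n addnCA addSn.
have := sums; rewrite /energy /jump addSnnS h_rec => e; lra.
Qed.

(** By linearity the jumps solve the same averaging recurrence, so a bound on the
    first p + 1 of them persists. Among these, each jump is half the previous one
    plus a difference of consecutive initial values; this preserves the bound
    2 l. *)
Lemma jump_le (l : R) : (forall j, (j < p)%N -> `|h j.+1 - h j| <= l) ->
  `|jump 0| <= 2 * l -> forall N, `|jump N| <= 2 * l.
Proof.
move=> lip j0.
have init N : (N <= p)%N -> `|jump N| <= 2 * l.
  elim: N => // N IH Np; have := IH (ltnW Np); have := lip N Np.
  rewrite /jump addSnnS h_rec !ler_norml => /andP[? ?] /andP[? ?].
  by apply/andP; split; lra.
move=> N; have [M] := ubnP N; elim: M N => // M IH N NM.
have [|pN] := leqP N p; first exact: init.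
have [K NK] : exists K, N = (K + p.+1)%N by exists (N - p.+1)%N; rewrite subnK.
have h1 : `|jump (K + p)| <= 2 * l by apply: IH; rewrite NK in NM; lia.
have h2 : `|jump K| <= 2 * l by apply: IH; rewrite NK in NM; lia.
have -> : jump N = (jump (K + p) + jump K) / 2.
  rewrite NK /jump; have := h_rec (K + p); have := h_rec K.
  by rewrite addnAC => -> ->; field.
by move: h1 h2; rewrite !ler_norml => /andP[? ?] /andP[? ?]; apply/andP; split; lra.
Qed.

Lemma energy_ge (l : R) c N : (forall j, (j < p)%N -> `|h j.+1 - h j| <= l) ->
  `|jump 0| <= 2 * l -> energy c 0 - 2 * N%:R * l ^+ 2 <= energy c N.
Proof.
move=> lip j0; elim: N => [|N IH]; first by rewrite mulr0 mul0r subr0.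
have := jump_le lip j0 N; rewrite -ler_sqr ?nnegrE // => [jN|].
  rewrite energyS -[N.+1]addn1 natrD; move: jN.
  by rewrite real_normK ?num_real //; lra.
by apply: le_trans (normr_ge0 _) j0.
Qed.

End AveragingRecurrence.

(** * A wave with plateaus at 1 and -1 *)

Section Profile.
Variables (R : realType) (q : nat).
Hypothesis q0 : (0 < q)%N.

Definition clamp (x : R) : R := Num.max (-1) (Num.min 1 x).

Lemma clamp_cases x : [\/ x <= -1 /\ clamp x = -1,
  -1 <= x <= 1 /\ clamp x = x | 1 <= x /\ clamp x = 1].
Proof.
rewrite /clamp; have [x1|x1] := leP 1 x.
  by constructor 3; split=> //; apply: max_r; lra.
have [xN|xN] := leP x (-1).
  by constructor 1.
by constructor 2; rewrite !ltW.
Qed.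

Lemma clamp_lip x y : `|clamp x - clamp y| <= `|x - y|.
Proof.
have := ler_norm (x - y); have := ler_norm (y - x); rewrite (distrC y x).
move: `|x - y| => d hyx hxy; rewrite ler_norml; apply/andP.
by case: (clamp_cases x) => -[hx ->]; case: (clamp_cases y) => -[hy ->]; split; lra.
Qed.

Lemma clamp_norm x : `|clamp x| <= 1.
Proof.
by rewrite ler_norml; apply/andP; case: (clamp_cases x) => -[hx ->]; split; lra.
Qed.

Lemma clamp_ge1 x : 1 <= x -> clamp x = 1.
Proof. by move=> x1; case: (clamp_cases x) => -[hx ->]; lra. Qed.

Lemma clamp_leN1 x : x <= -1 -> clamp x = -1.
Proof. by move=> x1; case: (clamp_cases x) => -[hx ->]; lra. Qed.

(** Equal to 1 up to 3q and from 8q on, and to -1 between 4q and 7q: the values at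
    0 and at any n >= 8q agree, so that wrapping a window of n points around a
    cycle creates no large jump. *)
Definition wave j : R := clamp (2 / q%:R * (`|j%:R - 11 / 2 * q%:R| - 2 * q%:R)).

Let qR : 0 < q%:R :> R. Proof. by rewrite ltr0n. Qed.

Lemma wave_lip j : `|wave j.+1 - wave j| <= 2 / q%:R.
Proof.
apply: le_trans (clamp_lip _ _) _.
have q2 : 0 <= 2 / q%:R :> R by rewrite divr_ge0 // ltW.
rewrite -mulrBr normrM (ger0_norm q2) ler_piMr //.
rewrite opprB addrA subrK; apply: le_trans (ler_dist_dist _ _) _.
rewrite -addn1 natrD.
have -> : j%:R + 1%:R - 11 / 2 * q%:R - (j%:R - 11 / 2 * q%:R) = 1 :> R by lra.
by rewrite normr1.
Qed.

Lemma wave_high j : (j <= 3 * q)%N \/ (8 * q <= j)%N -> wave j = 1.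
Proof.
move=> hj; apply: clamp_ge1.
have : 5 / 2 * q%:R <= `|j%:R - 11 / 2 * q%:R| :> R.
  case: hj; rewrite -(ler_nat R) natrM => hj.
    by rewrite distrC; apply: le_trans (ler_norm _); lra.
  by apply: le_trans (ler_norm _); lra.
by move=> h; rewrite mulrAC ler_pdivlMr //; lra.
Qed.

Lemma wave_low j : (4 * q <= j)%N -> (j <= 7 * q)%N -> wave j = -1.
Proof.
rewrite -!(ler_nat R) !natrM => h1 h2; apply: clamp_leN1.
have : `|j%:R - 11 / 2 * q%:R| <= 3 / 2 * q%:R :> R.
  by rewrite ler_norml; apply/andP; split; lra.
by move=> h; rewrite mulrAC ler_pdivrMr //; lra.
Qed.

(** Each of the two plateaus has 3q points, and (1 - c)^2 + (1 + c)^2 >= 2. *)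
Lemma wave_spread n c : (7 * q <= n)%N ->
  6 * q%:R <= \sum_(j < n) (wave j - c) ^+ 2.
Proof.
move=> qn; rewrite -(big_mkord xpredT (fun j => (wave j - c) ^+ 2)).
have ge0 a b : 0 <= \sum_(a <= j < b) (wave j - c) ^+ 2.
  by apply: sumr_ge0 => j _; apply: sqr_ge0.
rewrite (@big_cat_nat _ _ _ (3 * q)) //=; last lia.
rewrite (@big_cat_nat _ _ _ (4 * q) (3 * q)) //=; [|lia|lia].
rewrite (@big_cat_nat _ _ _ (7 * q) (4 * q)) //=; [|lia].
have -> : \sum_(0 <= j < 3 * q) (wave j - c) ^+ 2 = 3 * q%:R * (1 - c) ^+ 2.
  rewrite (eq_big_nat _ _ (F2 := fun=> (1 - c) ^+ 2)); last first.
    by move=> j /andP[_ h]; rewrite wave_high //; left; apply: ltnW.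
  by rewrite sumr_const_nat subn0 -[LHS]mulr_natl natrM.
have -> : \sum_(4 * q <= j < 7 * q) (wave j - c) ^+ 2 = 3 * q%:R * (-1 - c) ^+ 2.
  rewrite (eq_big_nat _ _ (F2 := fun=> (-1 - c) ^+ 2)); last first.
    by move=> j /andP[h h']; rewrite wave_low // ltnW.
  by rewrite sumr_const_nat -mulnBl -[LHS]mulr_natl natrM.
have := ge0 (3 * q)%N (4 * q)%N; have := ge0 (7 * q)%N n.
have := mulr_ge0 (ltW qR) (sqr_ge0 c); lra.
Qed.

End Profile.

(** * The uniform distribution on a star *)

Section Star.
Variables (R : realType) (p : nat).
Notation n := p.+1.

Definition bits : 'I_n -> finType := fun _ => bool.

(** The hub is None, the leaf e_i is Some i. *)
Definition star (o : option 'I_n) : config bits :=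
  [ffun j : 'I_n => (o == Some j : bits j)].

Definition star_distr (x : config bits) : R :=
  if x \in codom star then n.+1%:R^-1 else 0.
Notation pi := star_distr.

Lemma star_inj : injective star.
Proof.
have E o j : star o j = (o == Some j) by rewrite ffunE.
move=> [i|] [j|] // /ffunP e.
- by have := e i; rewrite !E eqxx => /esym/eqP.
- by have := e i; rewrite !E eqxx.
- by have := e j; rewrite !E eqxx.
Qed.

Lemma star_supp o : star o \in supp pi.
Proof. by rewrite inE /star_distr codom_f invr_neq0 // pnatr_eq0. Qed.

Definition star_ix o : 'I_#|supp pi| := enum_rank_in (star_supp None) (star o).

Lemma star_ixK o : enum_val (star_ix o) = star o.
Proof. by rewrite enum_rankK_in ?star_supp. Qed.

Lemma star_ix_inj : injective star_ix.
Proof. by move=> o o' /(congr1 enum_val); rewrite !star_ixK => /star_inj. Qed.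

Lemma star_ix_surj a : exists o, a = star_ix o.
Proof.
have := enum_valP a; rewrite inE /star_distr.
case: ifP => [/codomP[o e] _|]; last by rewrite eqxx.
by exists o; apply: enum_val_inj; rewrite star_ixK.
Qed.

Lemma star_ix_bij : bijective star_ix.
Proof.
apply: inj_card_bij; first exact: star_ix_inj.
rewrite card_ord -(card_codom star_inj) subset_leq_card //.
apply/subsetP => x; rewrite inE /star_distr; case: ifP => //; by rewrite eqxx.
Qed.

Lemma stat_star o : stat pi (star_ix o) = n.+1%:R^-1.
Proof. by rewrite /stat star_ixK /star_distr codom_f. Qed.

Lemma star_is_distr : is_distr pi.
Proof.
split=> [x|]; first by rewrite /star_distr; case: ifP; rewrite ?invr_ge0.
rewrite -big_mkcond /= sumr_const (card_codom star_inj) card_option card_ord.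
by rewrite -[LHS]mulr_natl divff // pnatr_eq0.
Qed.

Let w0 := stat_gt0 star_is_distr.
Let w1 := stat_sum1 star_is_distr.

Lemma big_star (Q : pred 'I_#|supp pi|) (F : 'I_#|supp pi| -> R) :
  \sum_(a | Q a) F a = \sum_(o | Q (star_ix o)) F (star_ix o).
Proof. by rewrite (reindex star_ix) //; apply: onW_bij star_ix_bij. Qed.

Lemma big_option (F : option 'I_n -> R) : \sum_o F o = F None + \sum_i F (Some i).
Proof.
rewrite (bigD1 None) //=; congr (_ + _).
rewrite (reindex_omap Some id) /= => [|[]//].
by apply: eq_bigl => i; rewrite eqxx.
Qed.

Implicit Types (v : 'cV[R]_#|supp pi|).

(** From the hub or from the leaf e_i, updating site i chooses between these two
    states; any other state is left unchanged. *)
Definition near i : pred (option 'I_n) := fun o => (o == None) || (o == Some i).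

Lemma agree_off_star i o o' :
  agree_off i (star o) (star o') = (o == o') || near i o && near i o'.
Proof.
have E u j : star u j = (u == Some j) by rewrite ffunE.
apply/forallP/orP => [h|[/eqP-> j|/andP[no no'] j]].
- have far u : near i u || [exists j, (j != i) && (u == Some j)].
    case: u => [j|//]; rewrite /near /=; case: (eqVneq (Some j) (Some i)) => //= ji.
    by apply/existsP; exists j; rewrite eqxx andbT; apply: contra ji => /eqP->.
  case/orP: (far o) => [no|/existsP[j /andP[ji /eqP oj]]].
    case/orP: (far o') => [no'|/existsP[j /andP[ji /eqP oj]]].
      by right; rewrite no.
    by left; have := h j; rewrite ji !E oj eqxx => /eqP/eqP->.
  by left; have := h j; rewrite ji !E oj eqxx eq_sym => /eqP/eqP->.
- by rewrite eqxx implybT.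
apply/implyP => ji; rewrite !E.
have nn u : near i u -> (u == Some j) = false.
  by case/orP => /eqP -> //; apply/negP => /eqP[] /eqP; rewrite eq_sym (negPf ji).
by rewrite !nn.
Qed.

Lemma star_site i (v : 'cV[R]_#|supp pi|) o :
  (P_site pi i *m v) (star_ix o) 0 =
  if near i o then (v (star_ix None) 0 + v (star_ix (Some i)) 0) / 2
  else v (star_ix o) 0.
Proof.
have c0 : n.+1%:R != 0 :> R by rewrite pnatr_eq0.
rewrite P_site_mulE !big_star !star_ixK.
under eq_bigl => o' do rewrite star_ixK agree_off_star.
under [in X in _ / X]eq_bigl => o' do rewrite star_ixK agree_off_star.
under eq_bigr do rewrite stat_star.
under [in X in _ / X]eq_bigr do rewrite stat_star.
case: ifP => no.
  have E F : \sum_(o' | (o == o') || near i o') F o' = F None + F (Some i) :> R.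
    rewrite (bigD1 None) ?orbT //= (bigD1 (Some i)) /=; last by rewrite /near eqxx !orbT.
    rewrite big_pred0 ?addr0 // => o'.
    have -> : (o == o') || near i o' = near i o' by case: eqP => // <-.
    by rewrite /near; case: eqP; case: eqP.
  by rewrite /= !E; field.
under eq_bigl do rewrite orbF eq_sym.
under [in X in _ / X]eq_bigl do rewrite orbF eq_sym.
by rewrite !big_pred1_eq mulrAC divff ?mul1r // invr_neq0.
Qed.

Lemma mean_star v : mean (stat pi) v =
  (v (star_ix None) 0 + \sum_i v (star_ix (Some i)) 0) / n.+1%:R.
Proof.
rewrite /mean big_star; under eq_bigr do rewrite stat_star mulrC.
by rewrite -mulr_suml big_option.
Qed.

Definition leaf_mean (v : 'cV[R]_#|supp pi|) : R :=
  (\sum_i v (star_ix (Some i)) 0) / n%:R.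

Let nR0 : n%:R != 0 :> R. Proof. by rewrite pnatr_eq0. Qed.

Lemma GD_hub v : (P_GD pi *m v) (star_ix None) 0 =
  (v (star_ix None) 0 + leaf_mean v) / 2.
Proof.
rewrite -scalemxAl mulmx_suml mxE summxE.
under eq_bigr do rewrite star_site /=.
rewrite -mulr_suml big_split /= sumr_const card_ord -[_ *+ _]mulr_natl /leaf_mean.
by field.
Qed.

Lemma GD_leaf v j : (P_GD pi *m v) (star_ix (Some j)) 0 =
  v (star_ix (Some j)) 0 +
  (v (star_ix None) 0 - v (star_ix (Some j)) 0) / (2 * n%:R).
Proof.
rewrite -scalemxAl mulmx_suml mxE summxE (bigD1 j) //= star_site /near /= eqxx.
under eq_bigr => i ij.
  rewrite star_site /near /= (_ : (Some j == Some i) = false); first over.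
  by apply/negP => /eqP[] /eqP; rewrite eq_sym (negPf ij).
have -> : \sum_(i < n | i != j) v (star_ix (Some j)) 0 =
    n%:R * v (star_ix (Some j)) 0 - v (star_ix (Some j)) 0.
  have : \sum_(i < n) v (star_ix (Some j)) 0 = n%:R * v (star_ix (Some j)) 0.
    by rewrite sumr_const card_ord mulr_natl.
  rewrite (bigD1 j) //= => <-; ring.
by field.
Qed.

Lemma GD_leaf_mean v : leaf_mean (P_GD pi *m v) =
  leaf_mean v + (v (star_ix None) 0 - leaf_mean v) / (2 * n%:R).
Proof.
rewrite /leaf_mean; under eq_bigr do rewrite GD_leaf.
rewrite big_split /= -mulr_suml sumrB sumr_const card_ord -[_ *+ _]mulr_natl.
by field.
Qed.

Definition slow_rate : R := 1 - (2 * n%:R)^-1.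
Definition fast_rate : R := 1 / 2 - (2 * n%:R)^-1.

Lemma mean_starE v : mean (stat pi) v =
  (v (star_ix None) 0 + n%:R * leaf_mean v) / (n%:R + 1).
Proof.
have n2 : p.+2%:R = p.+1%:R + 1 :> R by rewrite -[p.+2]addn1 natrD.
rewrite mean_star n2 /leaf_mean; congr (_ / _); congr (_ + _).
by rewrite mulrC divfK.
Qed.

Let nR1 : n%:R + 1 != 0 :> R. Proof. by rewrite natr1 pnatr_eq0. Qed.

(** Up to its mean, a function splits into a part constant on the leaves and a
    part vanishing at the hub with sum 0 over the leaves: these are eigenvectors,
    for the fast and the slow rate respectively. *)
Lemma GD_power t v :
  (P_GD pi ^+ t *m v) (star_ix None) 0 = mean (stat pi) v -
    fast_rate ^+ t * (n%:R / (n%:R + 1) * (leaf_mean v - v (star_ix None) 0)) /\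
  forall j, (P_GD pi ^+ t *m v) (star_ix (Some j)) 0 = mean (stat pi) v +
    slow_rate ^+ t * (v (star_ix (Some j)) 0 - leaf_mean v) +
    fast_rate ^+ t * ((leaf_mean v - v (star_ix None) 0) / (n%:R + 1)).
Proof.
elim: t v => [|t IH] v.
  by split=> [|j]; rewrite mulmx_expr0 mean_starE !expr0; field.
have [IH1 IH2] := IH (P_GD pi *m v).
have mP : mean (stat pi) (P_GD pi *m v) = mean (stat pi) v.
  by rewrite !mean_starE GD_hub GD_leaf_mean; field; rewrite nat1r nR0 nR1.
split=> [|j]; rewrite mulmx_expr.
  rewrite IH1 mP GD_hub GD_leaf_mean exprS.
  set x := fast_rate ^+ t; rewrite /fast_rate; field; by rewrite nat1r nR0 nR1.
rewrite IH2 mP GD_leaf GD_hub GD_leaf_mean !exprS.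
set x := fast_rate ^+ t; set y := slow_rate ^+ t.
by rewrite /fast_rate /slow_rate; field; rewrite nat1r nR0 nR1.
Qed.

Lemma star_GD_mixes : tv_dist (P_GD pi) (stat pi) (14 * n) <= 1 / 4.
Proof.
have n1 : 1 <= n%:R :> R by rewrite ler1n.
have n0 : 0 < n%:R :> R by lra.
have d0 : 0 < (2 * n%:R)^-1 :> R by rewrite invr_gt0; lra.
have d1 : (2 * n%:R)^-1 <= 1 / 2 :> R by rewrite div1r lef_pV2 ?posrE //; lra.
have slow0 : 0 <= slow_rate by rewrite /slow_rate; move: d1; set d := _^-1; lra.
have fast0 : 0 <= fast_rate by rewrite /fast_rate; move: d1; set d := _^-1; lra.
(* 14 makes the exponent below equal to 7, and exp 7 >= 1 + 7. *)
have slow : slow_rate ^+ (14 * n) <= 1 / 8.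
  apply: (@le_trans _ _ (expR (- (2 * n%:R)^-1) ^+ (14 * n))).
    by rewrite lerXn2r ?nnegrE ?expR_ge0 // expR_ge1Dx.
  rewrite -(expRM_natl (14 * n) (- (2 * n%:R)^-1)) natrM.
  have -> : 14%:R * n%:R * - (2 * n%:R)^-1 = - 7 :> R by field.
  rewrite expRN div1r lef_pV2 ?posrE ?expR_gt0 //.
  by apply: le_trans (expR_ge1Dx _); lra.
have fast : fast_rate ^+ (14 * n) <= 1 / 8.
  apply: (@le_trans _ _ ((1 / 2) ^+ (14 * n))).
    by rewrite lerXn2r ?nnegrE //; rewrite /fast_rate; move: d0; set d := _^-1; lra.
  apply: (@le_trans _ _ ((1 / 2) ^+ 3)); last lra.
  by apply: ler_wiXn2l; [lra | lra | lia].
have f0 := exprn_ge0 (14 * n) fast0; have s0 := exprn_ge0 (14 * n) slow0.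
rewrite tv_dist_le; last lra.
apply/forallP => a; have [o ->] := star_ix_surj a.
have [s s1 ->] := tv_test (stat pi) (P_GD pi ^+ (14 * n)) (star_ix o).
have [hub leaf] := GD_power (14 * n) s.
have u1 : `|leaf_mean s| <= 1.
  rewrite /leaf_mean normrM normfV (ger0_norm (ltW n0)) ler_pdivrMr // mul1r.
  apply: le_trans (ler_norm_sum _ _ _) _.
  rewrite -[X in _ <= X%:R](card_ord n) -sumr_const; exact: ler_sum.
have h1 := s1 (star_ix None).
move: u1 h1; rewrite !ler_norml => /andP[? ?] /andP[? ?].
have k0 : 0 <= 1 / (n%:R + 1) :> R by rewrite divr_ge0 //; lra.
have k1 : 1 / (n%:R + 1) <= 1 :> R by rewrite ler_pdivrMr; lra.
case: o => [j|].
  rewrite leaf; have := s1 (star_ix (Some j)); rewrite ler_norml => /andP[? ?].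
  set e := slow_rate ^+ _ in slow s0 *; set g := fast_rate ^+ _ in fast f0 *.
  have : e * (s (star_ix (Some j)) 0 - leaf_mean s) <= e * 2 by rewrite ler_wpM2l //; lra.
  have : (leaf_mean s - s (star_ix None) 0) / (n%:R + 1) <= 2.
    rewrite ler_pdivrMr; lra.
  move=> /(ler_wpM2l f0); lra.
rewrite hub; set g := fast_rate ^+ _ in fast f0 *.
have : n%:R / (n%:R + 1) * (s (star_ix None) 0 - leaf_mean s) <= 2.
  rewrite mulrAC ler_pdivrMr; last lra.
  have : n%:R * (s (star_ix None) 0 - leaf_mean s) <= n%:R * 2 by rewrite ler_wpM2l; lra.
  lra.
move=> /(ler_wpM2l f0); lra.
Qed.

Variable sigma : {perm 'I_n}.

(** Site sigma j is updated at times j, j + n, ..., and what it then shares with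
    the hub is the average of the last hub value and of its own value, written n
    updates earlier. *)
Lemma star_scan h (v : 'cV[R]_#|supp pi|) :
  (forall N, h (N + n)%N = (h (N + p)%N + h N) / 2) ->
  (forall j : 'I_n, v (star_ix (Some (sigma j))) 0 = h j) ->
  v (star_ix None) 0 = h p ->
  forall t,
    (forall j : 'I_n, (P_SS pi sigma ^+ t *m v) (star_ix (Some (sigma j))) 0 =
       h (t * n + j)%N) /\
    (P_SS pi sigma ^+ t *m v) (star_ix None) 0 = h (t * n + p)%N.
Proof.
move=> rec vl vh; elim=> [|t [IHl IHh]].
  by rewrite mulmx_expr0; split=> [j|]; rewrite mul0n.
rewrite mulmx_exprl; set u := P_SS pi sigma ^+ t *m v in IHl IHh *.
rewrite /P_SS (prod_rev_sweep (fun i => P_site pi (sigma i))).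
set B := (X in sweep X).
suff main k : (k <= n)%N ->
    (forall j : 'I_n, (sweep B k *m u) (star_ix (Some (sigma j))) 0 =
       if (j < k)%N then h (t * n + n + j)%N else h (t * n + j)%N) /\
    (sweep B k *m u) (star_ix None) 0 = h (t * n + p + k)%N.
  have [ml mh] := main n (leqnn _); split=> [j|].
    by rewrite ml ltn_ord mulSnr.
  by rewrite mh mulSnr addnAC.
elim: k => [_|k IH kn].
  by rewrite mul1mx; split=> [j|]; rewrite ?IHl ?IHh ?addn0.
have [kl kh] := IH (ltnW kn).
have Bk : B k = P_site pi (sigma (Ordinal kn)) by rewrite /B insubT.
have avg : ((sweep B k *m u) (star_ix None) 0 +
    (sweep B k *m u) (star_ix (Some (sigma (Ordinal kn)))) 0) / 2 =
    h (t * n + n + k)%N.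
  rewrite kh kl /= ltnn addnAC (addnAC _ n) rec //.
split=> [j|]; rewrite sweepS Bk star_site /near /=; last first.
  by rewrite avg; congr h; lia.
rewrite avg (inj_eq (@Some_inj _)) (inj_eq (@perm_inj _ sigma)).
rewrite ltnS leq_eqVlt -val_eqE /=.
by case: eqP => [->//|_]; rewrite kl.
Qed.

(** If the chain is 1/4-mixed after t scans, the wave has been flattened to within
    1/2 of its mean, so its energy has fallen from at least 6q to at most
    (n + 1) / 4, which is at most 2q + 2. The t n updates lose at most 2 (2/q)^2
    each, where q is n / 8 rounded down. For n < 8 there is no wave, but there
    t >= 1 is enough. *)
Lemma star_scan_slow t : tv_dist (P_SS pi sigma) (stat pi) t <= 1 / 4 ->
  n%:R ^+ 2 / 16384 <= t%:R :> R.
Proof.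
move=> tv.
have t0 : (0 < t)%N.
  apply: (start_not_mixed w0 w1 _ tv
    (a := star_ix None) (b := star_ix (Some ord0))).
  by apply/negP => /eqP/star_ix_inj.
have t1 : 1 <= t%:R :> R by rewrite ler1n.
pose q := (n %/ 8)%N.
have [q0|q0] := posnP q.
  have n8 : n%:R <= 8 :> R by rewrite ler_nat; rewrite /q in q0; lia.
  have n0 : 0 <= n%:R :> R by [].
  nra.
have q8 : (8 * q <= n)%N by rewrite /q; lia.
have n8q : (n <= 8 * q + 7)%N by rewrite /q; lia.
have [h hx rec] := averaging_solution p (wave R q).
have [v vl vh] : exists2 v : 'cV[R]_#|supp pi|,
    forall j : 'I_n, v (star_ix (Some (sigma j))) 0 = h j &
    v (star_ix None) 0 = h p.
  have [g gK _] := star_ix_bij.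
  exists (\col_a if g a is Some i then h ((sigma^-1)%g i) else h p) => [j|].
    by rewrite mxE gK permK.
  by rewrite mxE gK.
have [sl sh] := star_scan rec vl vh t.
set c := mean (stat pi) v.
have v1 a : `|v a 0| <= 1.
  have [[i|] ->] := star_ix_surj a.
    by rewrite -(permKV sigma i) vl hx ?clamp_norm // -ltnS.
  by rewrite vh hx ?clamp_norm.
have near_c a : ((P_SS pi sigma ^+ t *m v) a 0 - c) ^+ 2 <= 1 / 4.
  have := test_le_tv (stat pi) (P_SS pi sigma ^+ t) a v1.
  have : dTV ((P_SS pi sigma ^+ t) a) (stat pi) <= 1 / 4.
    by move: tv; rewrite tv_dist_le; [move/forallP/(_ a) | lra].
  rewrite -/c => h1 h2.
  have : `|(P_SS pi sigma ^+ t *m v) a 0 - c| <= 1 / 2 by lra.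
  rewrite -ler_sqr ?nnegrE ?normr_ge0 //.
  by rewrite real_normK ?num_real //; lra.
have final : energy p h c (t * n) <= (n%:R + 1) / 4.
  rewrite /energy -sh.
  have : \sum_(j < n) (h (t * n + j)%N - c) ^+ 2 <= n%:R / 4.
    have -> : n%:R / 4 = \sum_(j < n) (1 / 4) :> R.
      by rewrite sumr_const card_ord -[RHS]mulr_natl; lra.
    by apply: ler_sum => j _; rewrite -sl.
  by have := near_c (star_ix None); lra.
have start : 6 * q%:R <= energy p h c 0.
  rewrite /energy ler_wpDl ?sqr_ge0 //.
  apply: le_trans (@wave_spread R q q0 n c _) _; first by lia.
  by apply: ler_sum => j _; rewrite add0n hx // -ltnS.
have qR : 1 <= q%:R :> R by rewrite ler1n.
have lip j : (j < p)%N -> `|h j.+1 - h j| <= 2 / q%:R.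
  by move=> jp; rewrite !hx ?wave_lip // ltnW.
have wrap : `|jump p h 0| <= 2 * (2 / q%:R).
  have w0n : wave R q 0 = wave R q n by rewrite !wave_high //; [right | left].
  rewrite /jump add0n !hx // w0n distrC.
  have := wave_lip R q p; have := normr_ge0 (wave R q n - wave R q p); lra.
have := energy_ge rec c (t * n) lip wrap.
have nR : n%:R <= 8 * q%:R + 7 :> R by rewrite -natrM -natrD ler_nat.
have n0 : 0 <= n%:R :> R by [].
set x : R := q%:R in qR start lip wrap nR *.
rewrite natrM => en.
have : 6 * x - 8 * (t%:R * n%:R) / x ^+ 2 <= (n%:R + 1) / 4.
  have -> : 8 * (t%:R * n%:R) / x ^+ 2 = 2 * (t%:R * n%:R) * (2 / x) ^+ 2 by field; lra.
  lra.
have x2 : 0 < x ^+ 2 by rewrite exprn_gt0 //; lra.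
rewrite lerBlDr -lerBlDl ler_pdivlMr // => main.
have cube : x ^+ 3 <= 4 * (t%:R * n%:R).
  have : 2 * x * x ^+ 2 <= 8 * (t%:R * n%:R).
    by apply: le_trans main; rewrite ler_wpM2r ?(ltW x2) //; lra.
  by lra.
have sq : x ^+ 2 <= 60 * t%:R.
  have x0 : 0 < x by lra.
  rewrite -(ler_pM2l x0) -exprS; apply: le_trans cube _.
  have : t%:R * n%:R <= t%:R * (15 * x) by rewrite ler_wpM2l //; lra.
  lra.
have : n%:R ^+ 2 <= (15 * x) ^+ 2 by rewrite lerXn2r ?nnegrE //; lra.
lra.
Qed.

End Star.

Theorem theorem1p1 (R : realType) :
  (exists C : R, 0 < C /\
     forall eps : R, 0 < eps -> eps <= 1 ->
     forall n : nat, (1 <= n)%N ->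
     forall (X : 'I_n -> finType) (pi : config X -> R), is_distr pi ->
     forall sigma : {perm 'I_n},
     (tmix_SS pi sigma eps <=
        (C * n%:R)%:E * tmix_GD pi (1 / 4) *
        (ln (1 / (eps * pi_min pi)))%:E)%E)
  /\
  (exists c : R, 0 < c /\
     forall n : nat, (1 <= n)%N ->
     exists (X : 'I_n -> finType) (pi : config X -> R),
       [/\ is_distr pi,
           (0 < tmix_GD pi (1 / 4))%E,
           (tmix_GD pi (1 / 4) < +oo)%E
         & forall sigma : {perm 'I_n},
             ((c * n%:R)%:E * tmix_GD pi (1 / 4) <=
                tmix_SS pi sigma (1 / 4))%E]).
Proof.
split.
  exists 8; split=> // eps e0 e1 n n0 X pi dpi sigma.
  exact: scan_tmix_le.
(* The star needs at least n^2 / 16384 scans and at most 14 n Glauber steps. *)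
exists (1 / 14 / 16384); split; first lra.
move=> [//|p] _; exists (@bits p), (@star_distr R p).
have dpi := star_is_distr R p.
have fast : (tmix_GD (@star_distr R p) (1 / 4) <= (14 * p.+1)%:R%:E)%E.
  exact/tmix_le/star_GD_mixes.
split=> //.
- apply: (@lt_le_trans _ _ 1%:E); first by rewrite lte_fin.
  apply: tmix_ge => t tv; rewrite ler1n.
  apply: (start_not_mixed (stat_gt0 dpi) (stat_sum1 dpi) _ tv
    (a := star_ix R None) (b := star_ix R (Some ord0))).
  by apply/negP => /eqP/star_ix_inj.
- by apply: le_lt_trans fast _; rewrite ltry.
move=> sigma; apply: (@le_trans _ _ (p.+1%:R ^+ 2 / 16384)%:E); last first.
  by apply: tmix_ge => t; apply: star_scan_slow.
have c0 : 0 <= 1 / 14 / 16384 * p.+1%:R :> R by apply: mulr_ge0; [lra | exact: ler0n].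
apply: le_trans (lee_wpmul2l _ fast) _; first by rewrite lee_fin.
by rewrite -EFinM lee_fin natrM; lra.
Qed.
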